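(* Let $\{\theta_N : N\in\mathbb{N}\}$ be the iterates of SGD-$k$ for the quadratic problem, and let $\theta^*$ be a homogeneous solution to the quadratic problem. (Convergence) If $0 < C_{N+1}$ and $$C_{N+1} < \begin{cases} \dfrac{2\lambda_1}{\lambda_1^2 + t_Q/k} & k > t_Q/(\lambda_1\lambda_m) \\[2mm] \dfrac{2\lambda_m}{\lambda_m^2 + t_Q/k} & k \le t_Q/(\lambda_1\lambda_m), \end{cases}\qquad (\ast)$$ then $\mathbb{E}[e_{N+1}] < \mathbb{E}[e_N]$. Moreover, if the step sizes $\{C_{N+1}\}$ satisfy $(\ast)$ and are uniformly bounded away from zero, then $\mathbb{E}[e_N]$ decays exponentially to zero. (Divergence) Moreover, there exists a deterministic constant $\rho_N > 1$ such that $\mathbb{E}[e_{N+1}\mid\theta_N] > \rho_N e_N$ with probability one, if either $C_{N+1} < 0$ or $$C_{N+1} > \frac{2\lambda_j}{\lambda_j^2 + s_Q/k},$$ where $$j = \begin{cases} 1 & k \le \dfrac{s_Q}{\lambda_1\lambda_2} \\[2mm] l \ \ (l\in\{2,\ldots,m-1\}) & \dfrac{s_Q}{\lambda_l\lambda_{l-1}} < k \le \dfrac{s_Q}{\lambda_{l+1}\lambda_l} \\[2mm] m & k > \dfrac{s_Q}{\lambda_m\lambda_{m-1}}. \end{cases}$$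
   Context: Quadratic problem. Let $(\Omega,\mathcal{F},\mathbb{P})$ be a probability space. Let $Q\in\mathbb{R}^{p\times p}$ be a nonzero, symmetric, positive semidefinite random matrix and $r\in\mathbb{R}^p$ a random vector lying in the image space of $Q$ with probability one, such that (1) $\mathbb{E}[Q]$ is finite, (2) $\mathbb{E}[Q\,\mathbb{E}[Q]\,Q]$ is finite, (3) $\mathbb{E}[Q\,\mathbb{E}[Q]\,r]$ is finite, and (4) $\mathbb{E}[r'Qr]$ is finite ($'$ denotes transpose). Let $\{(Q_N,r_N):N\in\mathbb{N}\}$ be independent copies of $(Q,r)$. The quadratic problem is to use these copies to determine a solution, i.e. a $\theta^*\in\operatorname{argmin}_{\theta\in\mathbb{R}^p}\ \frac12\theta'\mathbb{E}[Q]\theta + \mathbb{E}[r]'\theta$. Homogeneous solution. A solution $\theta^*$ is called homogeneous if $\theta^*\in\operatorname{argmin}_{\theta\in\mathbb{R}^p}\frac12\theta'Q\theta + r'\theta$ with probability one; otherwise it is called inhomogeneous. SGD-$k$. For a positive integer $k$ (batch size), an arbitrary $\theta_0\in\mathbb{R}^p$ and a (deterministic) sequence of scalars $\{C_N\}$ (step sizes), SGD-$k$ generates $$\theta_{N+1} = \theta_N - \frac{C_{N+1}}{k}\sum_{j=Nk+1}^{(N+1)k}\left(Q_j\theta_N + r_j\right),\qquad N=0,1,2,\ldots$$ Notation. $m=\operatorname{rank}(\mathbb{E}[Q])$; $\lambda_1\ge\cdots\ge\lambda_m>0$ are the nonzero eigenvalues of $\mathbb{E}[Q]$; $e_N=(\theta_N-\theta^*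 )'\mathbb{E}[Q](\theta_N-\theta^* )$; and $t_Q$, $s_Q$ are respectively the supremum and the infimum of $$\frac{v'\mathbb{E}[Q\,\mathbb{E}[Q]\,Q]v - v'\mathbb{E}[Q]^3v}{v'\mathbb{E}[Q]v}$$ over all $v\in\mathbb{R}^p$ with $v'\mathbb{E}[Q]v\neq 0$.
   Formalization: Strict decrease of E[e_N] is stated only when E[e_N] > 0; the divergence inequality only where e_N > 0; and exponential decay also assumes the step sizes stay uniformly below the upper bound in (∗), since each literal claim fails otherwise. *)

(* Defs.v *)
From HB Require Import structures.
From mathcomp Require Import all_boot all_order all_algebra.
From mathcomp Require Import all_classical all_reals all_analysis.
Set Implicit Arguments.
Unset Strict Implicit.
Unset Printing Implicit Defensive.
Import Order.TTheory GRing.Theory Num.Theory.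
Local Open Scope classical_set_scope.
Local Open Scope ring_scope.

(* The product sigma-algebra on matrices, generated by the entries; over the
   reals this is the Borel sigma-algebra. *)
Definition mx_salgebra d (V : measurableType d) (m n : nat) :
    set (set 'M[V]_(m, n)) :=
  <<s \bigcup_(ij in [set: 'I_m * 'I_n])
        preimage_set_system setT (fun M : 'M[V]_(m, n) => M ij.1 ij.2)
          measurable >>.

Definition measure_mx_display : measure_display -> measure_display.
Proof. exact. Qed.

Section measurable_mx.
Context {d} {V : measurableType d} (m n : nat).

Let mx_set0 : mx_salgebra (set0 : set 'M[V]_(m, n)).
Proof. exact: sigma_algebra0. Qed.

Let mx_setC (A : set 'M[V]_(m, n)) : mx_salgebra A -> mx_salgebra (~` A).
Proof. exact: sigma_algebraC. Qed.

Let mx_bigcup (F : (set 'M[V]_(m, n))^nat) :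
  (forall i, mx_salgebra (F i)) -> mx_salgebra (\bigcup_i (F i)).
Proof. exact: sigma_algebra_bigcup. Qed.

HB.instance Definition _ := @isMeasurable.Build (measure_mx_display d)
  'M[V]_(m, n) (@mx_salgebra d V m n) mx_set0 mx_setC mx_bigcup.

End measurable_mx.

Section probability_notions.
Context {d} {T : measurableType d} {R : realType} (P : probability T R).

Definition eq_law d' (U : measurableType d') (X Y : T -> U) : Prop :=
  forall B, measurable B -> P (X @^-1` B) = P (Y @^-1` B).

Definition mutually_independent d' (U : measurableType d')
    (X : nat -> T -> U) : Prop :=
  forall (J : seq nat) (B : nat -> set U), uniq J ->
    (forall j, measurable (B j)) ->
    P (\bigcap_(j in [set` J]) (X j @^-1` B j)) =
    (\prod_(j <- J) P (X j @^-1` B j))%E.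

Definition independent_copies d' (U : measurableType d')
    (X : T -> U) (Xs : nat -> T -> U) : Prop :=
  (forall N, eq_law (Xs N) X) /\ mutually_independent Xs.

Definition is_cond_exp (G : set (set T)) (X Y : T -> R) : Prop :=
  [/\ forall B : set R, measurable B -> G (Y @^-1` B),
      P.-integrable setT (EFin \o Y) &
      forall A, G A ->
        (\int[P]_(w in A) (Y w)%:E = \int[P]_(w in A) (X w)%:E)%E].

(* A version of E[X | Z], or the constant function 0 if there is none. *)
Definition cond_exp d' (U : measurableType d') (X : T -> R) (Z : T -> U) :
    T -> R :=
  xget (fun=> 0) [set Y | is_cond_exp (g_sigma_algebra_preimage Z) X Y].

Definition mx_integrable m n (X : T -> 'M[R]_(m, n)) : Prop :=
  forall i j, P.-integrable setT (EFin \o (fun w => X w i j)).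

Definition mx_mean m n (X : T -> 'M[R]_(m, n)) : 'M[R]_(m, n) :=
  \matrix_(i, j) fine 'E_P[fun w => X w i j].

End probability_notions.

Section quadratic_forms.
Context {R : realType} {p : nat}.

Definition qform (A : 'M[R]_p) (v : 'cV[R]_p) : R := (v^T *m A *m v) 0 0.

Definition psd (A : 'M[R]_p) : Prop := A^T = A /\ forall v, 0 <= qform A v.

Definition quad_obj (A : 'M[R]_p) (b v : 'cV[R]_p) : R :=
  2^-1 * qform A v + (b^T *m v) 0 0.

Definition is_argmin (f : 'cV[R]_p -> R) (v : 'cV[R]_p) : Prop :=
  forall u, f v <= f u.

(* lambda 1 >= ... >= lambda m > 0, with m the rank of A, are the nonzero
   eigenvalues of A counted with multiplicity; other values of lambda are
   irrelevant. *)
Definition nonzero_eigenvalues (A : 'M[R]_p) (lambda : nat -> R) : Prop :=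
  let m := \rank A in
  [/\ forall i j : nat, (1 <= i)%N -> (i <= j <= m)%N -> lambda j <= lambda i,
      forall i : nat, (1 <= i <= m)%N -> 0 < lambda i &
      char_poly A =
        'X^(p - m) * \prod_(1 <= i < m.+1) ('X - (lambda i)%:P)].

End quadratic_forms.

Section quadratic_problem.
Context {d} {T : measurableType d} {R : realType} (P : probability T R).
Context {p : nat} (Q : T -> 'M[R]_p) (r : T -> 'cV[R]_p).

Let EQ := mx_mean P Q.

Record quadratic_problem : Prop := QuadraticProblem {
  qp_nonzero : ~ {ae P, forall w, Q w = 0} ;
  qp_psd : {ae P, forall w, psd (Q w)} ;
  qp_image : {ae P, forall w, exists x, r w = Q w *m x} ;
  qp_EQ : mx_integrable P Q ;
  qp_EQEQQ : mx_integrable P (fun w => Q w *m EQ *m Q w) ;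
  qp_EQEQr : mx_integrable P (fun w => Q w *m EQ *m r w) ;
  qp_ErQr : mx_integrable P (fun w => (r w)^T *m Q w *m r w) }.

Definition solution (theta : 'cV[R]_p) : Prop :=
  is_argmin (quad_obj EQ (mx_mean P r)) theta.

Definition homogeneous_solution (theta : 'cV[R]_p) : Prop :=
  solution theta /\ {ae P, forall w, is_argmin (quad_obj (Q w) (r w)) theta}.

Definition variance_quotients : set R :=
  [set (qform (mx_mean P (fun w => Q w *m EQ *m Q w)) v - qform (EQ ^+ 3) v)
         / qform EQ v
  | v in [set v | qform EQ v != 0]].

Definition t_Q : R := sup variance_quotients.
Definition s_Q : R := inf variance_quotients.

End quadratic_problem.

Section sgd.
Context {T : Type} {R : realType} {p : nat}.
Variables (Qs : nat -> T -> 'M[R]_p) (rs : nat -> T -> 'cV[R]_p).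
Variables (k : nat) (C : nat -> R) (theta0 : 'cV[R]_p).

Fixpoint sgd (N : nat) (w : T) : 'cV[R]_p :=
  if N is N'.+1 then
    sgd N' w - (C N / k%:R) *:
      \sum_((N' * k).+1 <= j < (N * k).+1) (Qs j w *m sgd N' w + rs j w)
  else theta0.

End sgd.

Section step_size_bounds.
Context {R : realType} (lambda : nat -> R) (m k : nat).

Definition step_threshold (tau : R) (i : nat) : R :=
  2 * lambda i / (lambda i ^+ 2 + tau / k%:R).

Definition convergence_bound (t : R) : R :=
  if t / (lambda 1%N * lambda m) < k%:R
  then step_threshold t 1 else step_threshold t m.

(* When m = 1, where lambda 2 and lambda (m - 1) are not eigenvalues, the only
   index is 1. *)
Definition divergence_index (s : R) (j : nat) : Prop :=
  [\/ j = 1%N /\ ((1 < m)%N -> k%:R <= s / (lambda 1%N * lambda 2%N)),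
      (2 <= j <= m.-1)%N /\
        s / (lambda j * lambda j.-1) < k%:R <= s / (lambda j.+1 * lambda j) |
      j = m /\ ((1 < m)%N -> s / (lambda m * lambda m.-1) < k%:R)].

End step_size_bounds.

(* Main.v *)
Require Import Defs.
From HB Require Import structures.
From mathcomp Require Import all_boot all_order all_algebra.
From mathcomp Require Import complex sesquilinear spectral ring lra zify.
From mathcomp Require Import all_classical all_reals all_analysis.
From mathcomp Require Import measurable_realfun.
Set Implicit Arguments.
Unset Strict Implicit.
Unset Printing Implicit Defensive.
Import Order.TTheory GRing.Theory Num.Theory.
Local Open Scope classical_set_scope.
Local Open Scope ring_scope.

(** Write A for the mean of Q, B for the mean of Q A Q, b = theta - thetas for
    the error, and e(b) = b^T A b for its energy.  A homogeneous solution
    satisfies Q thetas + r = 0 almost surely, so a step of the algorithm acts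
    linearly on the error, b |-> (I - (C / k) (sum of the Q_j)) b: all the noise
    is multiplicative, and it is independent of b.

    Averaging over the batch therefore turns e(b) into the deterministic form
    [step_mean], that is e(b - C A b) + (C^2 / k) D(b), where
    D(b) = b^T B b - b^T A^3 b = E[e((Q - A) b)] >= 0 is the [dispersion] of
    one sample.  Since ker A is contained in ker B, D is dominated by e, so that
    t_Q and s_Q are finite and are the best constants in
    s_Q e <= D <= t_Q e.  In an orthonormal eigenbasis of A the comparison of
    [step_mean] with e then becomes a scalar question for each nonzero
    eigenvalue l: the energy along it is multiplied by at most (with t = t_Q) or
    at least (with t = s_Q) the [step_factor] (1 - C l)^2 + C^2 t / k.  This
    number is below 1 exactly when 0 < C < 2 l / (l^2 + t / k).  As a function
    of l that threshold increases up to l^2 = t / k and decreases afterwards; so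
    over the spectrum its minimum is at lambda 1 or lambda m
    ([convergence_bound_le]), and its maximum is at the eigenvalue where
    consecutive products lambda_j lambda_(j+1) cross t / k
    ([divergence_index_max]).

    The probabilistic part is [integral_sgd_step]: for every nonnegative
    measurable weight phi,
    E[phi(theta_N) e(b_(N+1))] = E[phi(theta_N) step_mean(b_N)].
    Its proof consumes the batch one sample at a time.  A sample is independent
    of the sigma-algebra of the earlier ones by the pi-lambda theorem
    ([past_independent]), so the joint law is a product and Tonelli's theorem
    applies ([integral_independent]); [batch_energy] is the expected final
    energy when l samples of the batch are still to come.  The integrands are
    nonnegative, as Tonelli's theorem requires.  The weight 1 gives the recursion
    for E[e_N], which also shows that these means are finite; indicator weights
    show that step_mean(b_N) is a version of E[e_(N+1) | theta_N], and versions
    agree almost surely ([cond_exp_ae_eq]). *)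

(** * Quadratic forms *)

Section quadratic_form_algebra.
Context {R : realType} {p : nat}.
Implicit Types (A B M : 'M[R]_p) (u v w : 'cV[R]_p).

Definition bform A u v : R := (u^T *m A *m v) 0 0.

Lemma bformD2 A u v w : bform A u (v + w) = bform A u v + bform A u w.
Proof. by rewrite /bform mulmxDr mxE. Qed.

Lemma bformZ2 A u (a : R) v : bform A u (a *: v) = a * bform A u v.
Proof. by rewrite /bform -scalemxAr mxE. Qed.

Lemma bformC A u v : A^T = A -> bform A u v = bform A v u.
Proof.
move=> As; have -> : bform A u v = (u^T *m A *m v)^T 0 0 by rewrite mxE.
by rewrite !trmx_mul trmxK As mulmxA.
Qed.

Lemma qformE A u : qform A u = bform A u u. Proof. by []. Qed.

Lemma qform_comb A u v (a : R) : A^T = A ->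
  qform A (u - a *: v) = qform A u - 2 * a * bform A u v + a ^+ 2 * qform A v.
Proof.
move=> As; have D1 x : bform A (u - a *: v) x = bform A u x - a * bform A v x.
  by rewrite bformC// -scaleNr bformD2 bformZ2 mulNr !(bformC x).
by rewrite !qformE D1 -scaleNr !bformD2 !bformZ2 (bformC v u As); ring.
Qed.

Lemma bform_sum A u v : bform A u v = \sum_i \sum_j u i 0 * v j 0 * A i j.
Proof.
rewrite /bform mxE exchange_big; apply: eq_bigr => j _ /=.
rewrite mxE mulr_suml; apply: eq_bigr => i _; rewrite mxE; ring.
Qed.

Lemma qform_mul M A u : qform (M^T *m A *m M) u = qform A (M *m u).
Proof. by rewrite /qform trmx_mul !mulmxA. Qed.

(** A quadratic polynomial without constant term that is nonnegative everywhere
    has a critical point at 0: this is the first-order optimality condition in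
    one direction. *)
Lemma perturbation_ge0_eq0 (x y : R) :
  (forall a : R, 0 <= a * x + a ^+ 2 * y) -> x = 0.
Proof.
move=> h; have [//|x0] := eqVneq x 0.
(* The polynomial is negative near its minimum -x / (2 y); replacing 2 y by
   |y| + 1 avoids a case distinction on y. *)
have y1 : 0 < `|y| + 1 by rewrite ltr_wpDl.
have := h (- (x / (`|y| + 1))).
rewrite (_ : _ + _ = x ^+ 2 / (`|y| + 1) ^+ 2 * (y - `|y| - 1)); last first.
  by field; rewrite gt_eqF.
have : 0 < x ^+ 2 / (`|y| + 1) ^+ 2.
  by apply: divr_gt0; [rewrite lt_def sqr_ge0 sqrf_eq0 x0|exact: exprn_gt0].
move=> /pmulr_rge0 ->.
have := ler_norm y; lra.
Qed.

(** A zero of a positive semidefinite form is a minimum of it, so the gradient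
    vanishes there. *)
Lemma psd_qform_eq0 A v : psd A -> qform A v = 0 -> A *m v = 0.
Proof.
move=> [As A0] v0; apply/colP => i; rewrite [RHS]mxE.
have := @perturbation_ge0_eq0
  (- 2 * bform A v (delta_mx i 0)) (qform A (delta_mx i 0)).
have h a : 0 <= a * (- 2 * bform A v (delta_mx i 0))
                + a ^+ 2 * qform A (delta_mx i 0).
  have := A0 (v - a *: delta_mx i 0); rewrite qform_comb// v0.
  by congr (_ <= _); ring.
move=> /(_ h)/eqP; rewrite mulf_eq0 oppr_eq0 pnatr_eq0/= => /eqP.
by rewrite bformC// /bform -mulmxA trmx_delta -rowE mxE.
Qed.

Lemma argmin_stationary A (b v : 'cV[R]_p) : A^T = A ->
  is_argmin (quad_obj A b) v -> A *m v + b = 0.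
Proof.
move=> As vmin; apply/colP => i; rewrite [RHS]mxE.
set d : 'cV[R]_p := delta_mx i 0.
have dE (w : 'cV[R]_p) : (w^T *m d) 0 0 = w i 0 by rewrite /d -colE !mxE.
have := @perturbation_ge0_eq0 (- (A *m v + b) i 0) (2^-1 * qform A d).
have h a : 0 <= a * (- (A *m v + b) i 0) + a ^+ 2 * (2^-1 * qform A d).
  have := vmin (v - a *: d); rewrite /quad_obj qform_comb//.
  have -> : (b^T *m (v - a *: d)) 0 0 = (b^T *m v) 0 0 - a * b i 0.
    by rewrite -scaleNr mulmxDr -scalemxAr mxE [X in _ + X]mxE dE; ring.
  have -> : bform A v d = (A *m v) i 0.
    by rewrite bformC// /bform -mulmxA /d trmx_delta -rowE mxE.
  rewrite [(A *m v + b) i 0]mxE -subr_ge0.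
  by congr (_ <= _); field.
by move=> /(_ h)/eqP; rewrite oppr_eq0 => /eqP.
Qed.

End quadratic_form_algebra.

(** * The spectral theorem for a real symmetric matrix *)

Section spectral_moments.
Context {R : realType} {p : nat}.
Local Notation toC := (real_complex R).
Local Notation "M ^toC" := (map_mx toC M) (at level 2, format "M ^toC").

Lemma diagonalized_exp (K : fieldType) (M U : 'M[K]_p) (D : 'rV_p) (n : nat) :
  U \in unitmx -> M = invmx U *m diag_mx D *m U ->
  M ^+ n = invmx U *m diag_mx (\row_i D 0 i ^+ n) *m U.
Proof.
move=> Uunit ->; elim: n => [|n IH].
  rewrite expr0 (_ : diag_mx _ = 1%:M) ?mulmx1 ?mulVmx//.
  by apply/matrixP => i j; rewrite !mxE expr0.
rewrite exprS IH -[_ * _]/(_ *m _) !mulmxA mulmxK//.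
congr (_ *m _); rewrite -mulmxA mulmx_diag; congr (_ *m diag_mx _).
by apply/rowP => i; rewrite !mxE exprS.
Qed.

(** The spectral theorem, in the form that comparing quadratic forms needs: each
    vector has a nonnegative spectral measure, the weights c, whose n-th moment
    is the form of A ^+ n.  The matrix is diagonalized over the complex numbers
    by a unitary matrix U; its eigenvalues are real, and c i is the squared
    modulus of the i-th coordinate of U v. *)
Lemma spectral_moments (A : 'M[R]_p) : A^T = A ->
  exists2 d : 'I_p -> R, (forall i, root (char_poly A) (d i)) &
    forall v, exists2 c : 'I_p -> R, (forall i, 0 <= c i) &
      forall n, qform (A ^+ n) v = \sum_i d i ^+ n * c i.
Proof.
move=> As.
have mulE q (K : pzSemiRingType) (M N : 'M[K]_q) : M * N = M *m N by [].
have real_mx m n (M : 'M[R]_(m, n)) : M^toC \is a mxOver Num.real.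
  by apply/mxOverP => i j; rewrite mxE complex_real.
have Asym : A^toC \is @hermitianmx _ _ false idfun.
  by apply/is_hermitianmxP; rewrite expr0 scale1r map_mx_id// map_trmx As.
have An : A^toC \is normalmx by exact: symmetric_normalmx.
have Ah : A^toC \is @hermitianmx _ _ false Num.conj by exact: realsym_hermsym.
have /orthomx_spectralP := An.
have := hermitian_spectral_diag_real Ah.
have := spectral_unitarymx A^toC.
set U := spectralmx _; set D := spectral_diag _ => Uu /mxOverP Dr AE.
have Uunit := unitarymx_unit Uu.
exists (fun i => complex.Re (D 0 i)) => [i|v].
  rewrite -(fmorph_root toC) map_char_poly -eigenvalue_root_char /=.
  rewrite (RRe_real (Dr _ _)).
  (* The rows of U are left eigenvectors. *)
  apply/eigenvalueP; exists (row i U).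
    rewrite {1}AE !mulmxA -row_mul mulmxV//.
    by rewrite row1 -rowE row_diag_mx -scalemxAl -rowE.
  have := row_free_unit U; rewrite Uunit => /row_freeP[V UV].
  apply/negP => /eqP /(congr1 (mulmx^~ V)); rewrite -row_mul UV mul0mx row1.
  by move=> /rowP /(_ i) /eqP; rewrite !mxE !eqxx oner_eq0.
have Aexp n := diagonalized_exp n Uunit AE.
pose w := U *m v^toC.
exists (fun i => complex.Re (`|w i 0| ^+ 2)) => [i|n].
  by rewrite -(lecR 0) RRe_real ?exprn_ge0// realX// normr_real.
apply: (complexI); rewrite rmorph_sum /=.
have -> : (qform (A ^+ n) v)%:C%C = ((v^toC)^T *m A^toC ^+ n *m v^toC) 0 0.
  have -> : A^toC ^+ n = (A ^+ n)^toC.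
    elim: n => [|n IH]; first by rewrite !expr0 map_mx1.
    by rewrite !exprS !mulE map_mxM -IH.
  by rewrite map_trmx -!map_mxM mxE.
rewrite Aexp !mulmxA -[_ *m v^toC]mulmxA -/w.
have -> : (v^toC)^T *m invmx U = map_mx Num.conj w^T.
  rewrite invmx_unitary// /w trmx_mul map_mxM; congr (_ *m _).
  apply/matrixP => i j; rewrite !mxE; apply/esym/CrealP.
  by rewrite complex_real.
have normE i : toC (complex.Re (`|w i 0| ^+ 2)) = w i 0 * Num.conj (w i 0).
  rewrite -normCK; apply: RRe_real; exact: (realX _ (normr_real _)).
have DE i : toC (complex.Re (D 0 i)) = D 0 i by exact: RRe_real.
rewrite mul_mx_diag mxE; apply: eq_bigr => i _.
have -> x y : toC (x ^+ n * y) = toC x ^+ n * toC y by rewrite rmorphM rmorphXn.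
by rewrite normE DE !mxE; ring.
Qed.

End spectral_moments.

(** * Comparison of quadratic forms through the spectrum *)

Section spectral_comparison.
Context {R : realType} {p : nat}.
Implicit Types (A B N : 'M[R]_p) (u v : 'cV[R]_p).

Lemma qform1 u : qform 1%:M u = \sum_i u i 0 ^+ 2.
Proof.
by rewrite /qform mulmx1 mxE; apply: eq_bigr => i _; rewrite mxE expr2.
Qed.

Lemma qform_expS2 A v n : A^T = A ->
  qform (A ^+ n.+2) v = qform (A ^+ n) (A *m v).
Proof.
by move=> As; rewrite -qform_mul As exprS exprSr mulrA.
Qed.

Lemma qform_le_sqnorm N :
  exists2 K : R, 0 <= K & forall u, qform N u <= K * qform 1%:M u.
Proof.
exists (\sum_i \sum_j `|N i j|) => [|u].
  by apply: sumr_ge0 => i _; apply: sumr_ge0.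
rewrite qformE bform_sum mulr_suml; apply: ler_sum => i _.
rewrite mulr_suml; apply: ler_sum => j _.
have uu a : u a 0 ^+ 2 <= qform 1%:M u.
  by rewrite qform1 (bigD1 a)//= lerDl sumr_ge0// => b _; rewrite sqr_ge0.
have uv : `|u i 0 * u j 0| <= qform 1%:M u.
  have : `|u i 0 * u j 0| <= 2^-1 * (u i 0 ^+ 2 + u j 0 ^+ 2).
    have : 0 <= (`|u i 0| - `|u j 0|) ^+ 2 by rewrite sqr_ge0.
    rewrite normrM -(real_normK (num_real (u i 0))).
    rewrite -(real_normK (num_real (u j 0))).
    by move=> h; rewrite -subr_ge0; nra.
  have := uu i; have := uu j; lra.
rewrite mulrC; apply: le_trans (ler_norm _) _.
by rewrite normrM ler_wpM2l.
Qed.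

Variables (A : 'M[R]_p) (lambda : nat -> R).
Hypotheses (As : A^T = A) (Alambda : nonzero_eigenvalues A lambda).
Let m := \rank A.

(** The factor A kills the zero eigenvalues, so the polynomial
    x1 + x2 l + x3 l^2 only has to be nonnegative on the nonzero part of the
    spectrum. *)
Lemma spectral_ge0 (x1 x2 x3 : R) v :
  (forall j, (1 <= j <= m)%N -> 0 <= x1 + x2 * lambda j + x3 * lambda j ^+ 2) ->
  0 <= x1 * qform A v + x2 * qform (A ^+ 2) v + x3 * qform (A ^+ 3) v.
Proof.
have [_ lambda_gt0 char_polyE] := Alambda.
move=> x_ge0; have [d droot /(_ v)[c c0 moments]] := spectral_moments As.
rewrite -[in qform A v](expr1 A) !moments !mulr_sumr -!big_split/=.
apply: sumr_ge0 => i _.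
rewrite (_ : _ + _ = d i * (x1 + x2 * d i + x3 * d i ^+ 2) * c i); last by ring.
apply: mulr_ge0 => //; have := droot i.
rewrite char_polyE rootM => /orP[|].
  move=> /rootP; rewrite hornerXn => /eqP.
  by rewrite expf_eq0 => /andP[_ /eqP->]; rewrite mul0r.
rewrite /root horner_prod prodf_seq_eq0 => /hasP[j].
rewrite mem_index_iota ltnS => /= jm; rewrite hornerXsubC subr_eq0 => /eqP ->.
by rewrite mulr_ge0 ?x_ge0// ltW// lambda_gt0.
Qed.

Lemma qform_eigen_ge0 v : 0 <= qform A v.
Proof.
have := @spectral_ge0 1 0 0 v; rewrite !mul0r !addr0 mul1r; apply => j _.
by rewrite !mul0r !addr0.
Qed.

Lemma psd_eigen : psd A. Proof. by split=> // v; exact: qform_eigen_ge0. Qed.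

Lemma qform_sqr_le :
  exists2 K : R, 0 <= K & forall v, qform (A ^+ 2) v <= K * qform A v.
Proof.
have [lambda_mono lambda_gt0 _] := Alambda.
exists `|lambda 1%N| => // v.
have := @spectral_ge0 `|lambda 1%N| (-1) 0 v.
rewrite mul0r addr0 mulN1r subr_ge0; apply => j /andP[j1 jm].
rewrite mul0r addr0 mulN1r subr_ge0.
by rewrite (le_trans (lambda_mono 1%N j _ _)) ?ler_norm// j1.
Qed.

(** As the kernel of A lies in that of B, the rows and columns of B lie in the
    row space of A, and B factors as A N A with N built from a partial inverse
    of A.  Hence v^T B v = (A v)^T N (A v) is bounded by a multiple of |A v|^2,
    and |A v|^2 by a multiple of v^T A v. *)
Lemma qform_dominated B : B^T = B -> (forall v, A *m v = 0 -> B *m v = 0) ->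
  exists2 K : R, 0 <= K & forall v, qform B v <= K * qform A v.
Proof.
move=> Bs kerAB.
have BA : (B <= A)%MS.
  rewrite submxE; apply/eqP/matrixP => i j.
  have /kerAB : A *m (cokermx A *m delta_mx j 0 : 'cV_p) = 0.
    by rewrite mulmxA mulmx_coker mul0mx.
  by rewrite mulmxA -colE => /colP /(_ i); rewrite !mxE.
have [D BE] := submxP BA.
have BE' : B = A *m D^T by rewrite -[LHS]Bs BE trmx_mul As.
have BN : B = A^T *m (D^T *m pinvmx A) *m A.
  by rewrite As -{1}(mulmxKpV BA) {1}BE' !mulmxA.
have [K1 K10 leK1] := qform_le_sqnorm (D^T *m pinvmx A).
have [K2 K20 leK2] := qform_sqr_le.
exists (K1 * K2) => [|v]; first exact: mulr_ge0.
rewrite BN qform_mul (le_trans (leK1 _))// -mulrA ler_wpM2l//.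
by have := leK2 v; rewrite (qform_expS2 v 0 As) expr0.
Qed.

End spectral_comparison.

(** * The mean effect of one step *)

Section step_mean.
Context {R : realType} {p : nat}.
Variables (A B : 'M[R]_p) (lambda : nat -> R).
Hypotheses (As : A^T = A) (Alambda : nonzero_eigenvalues A lambda).
Let m := \rank A.
Hypothesis Bs : B^T = B.
Hypothesis kerAB : forall v : 'cV[R]_p, A *m v = 0 -> B *m v = 0.

(** When A is the mean of Q and B that of Q A Q, this is the mean A-energy of
    (Q - A) v. *)
Definition dispersion (v : 'cV[R]_p) : R := qform B v - qform (A ^+ 3) v.
Hypothesis dispersion_ge0 : forall v, 0 <= dispersion v.

Definition dispersion_quotients : set R :=
  [set dispersion v / qform A v | v in [set v | qform A v != 0]].

Let quotient_ge0 x : dispersion_quotients x -> 0 <= x.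
Proof. by case=> v _ <-; rewrite divr_ge0// (qform_eigen_ge0 As Alambda). Qed.

Let dispersion_eq0 v : qform A v = 0 -> dispersion v = 0.
Proof.
move=> /(psd_qform_eq0 (psd_eigen As Alambda)) Av0.
rewrite /dispersion (qform_expS2 v 1 As) /qform -mulmxA kerAB// Av0.
by rewrite !mulmx0 mxE subrr.
Qed.

Let qform_gt0 v : qform A v != 0 -> 0 < qform A v.
Proof. by move=> v0; rewrite lt_def v0 (qform_eigen_ge0 As Alambda). Qed.

Lemma sup_quotients_ge0 : 0 <= sup dispersion_quotients.
Proof.
have [->|/set0P[x Sx]] := eqVneq dispersion_quotients set0.
  by rewrite sup0.
have [K _ leK] := qform_dominated As Alambda Bs kerAB.
apply: le_trans (quotient_ge0 Sx) _; apply: ub_le_sup Sx.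
exists K => _ [v /qform_gt0 v0 <-].
rewrite ler_pdivrMr// (le_trans _ (leK v))//.
by rewrite /dispersion gerBl (qform_expS2 v 1 As) (qform_eigen_ge0 As Alambda).
Qed.

Lemma inf_quotients_ge0 : 0 <= inf dispersion_quotients.
Proof.
have [->|/set0P S0] := eqVneq dispersion_quotients set0; first by rewrite inf0.
exact: lb_le_inf.
Qed.

(** The bound extends to the vectors without quotient, because the dispersion
    vanishes on the kernel of A; domination makes the supremum finite. *)
Lemma dispersion_le_sup v :
  dispersion v <= sup dispersion_quotients * qform A v.
Proof.
have [v0|v0] := eqVneq (qform A v) 0.
  by rewrite dispersion_eq0// v0 mulr0.
have [K _ leK] := qform_dominated As Alambda Bs kerAB.
rewrite -ler_pdivrMr ?qform_gt0//; apply: ub_le_sup; last by exists v.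
exists K => _ [u /qform_gt0 u0 <-].
rewrite ler_pdivrMr// (le_trans _ (leK u))//.
by rewrite /dispersion gerBl (qform_expS2 u 1 As) (qform_eigen_ge0 As Alambda).
Qed.

Lemma inf_le_dispersion v :
  inf dispersion_quotients * qform A v <= dispersion v.
Proof.
have [v0|v0] := eqVneq (qform A v) 0.
  by rewrite dispersion_eq0// v0 mulr0.
rewrite -ler_pdivlMr ?qform_gt0//; apply: ge_inf; last by exists v.
by exists 0 => x; exact: quotient_ge0.
Qed.

Variable k : nat.

(** The expected energy of the error after one step of size C from v: the energy
    of the mean step, plus the variance that a batch of k independent samples
    leaves. *)
Definition step_mean (C : R) v : R :=
  qform A (v - C *: (A *m v)) + C ^+ 2 / k%:R * dispersion v.

Lemma step_meanE C v : step_mean C v =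
  qform A v - 2 * C * qform (A ^+ 2) v + C ^+ 2 * qform (A ^+ 3) v
  + C ^+ 2 / k%:R * dispersion v.
Proof.
rewrite /step_mean qform_comb// (qform_expS2 v 1 As) (qform_expS2 v 0 As).
congr (_ - _ * _ + _ + _).
by rewrite expr0 /bform /qform mulmx1 trmx_mul As.
Qed.

Lemma step_mean_ge0 C v : 0 <= step_mean C v.
Proof.
rewrite addr_ge0 ?(qform_eigen_ge0 As Alambda)// mulr_ge0//.
by rewrite divr_ge0// sqr_ge0.
Qed.

(** The factor (1 - C l)^2 + C^2 tau / k by which a step of size C multiplies
    the energy along an eigenvector for l, if the dispersion is tau times the
    energy. *)
Definition step_factor (tau C l : R) : R :=
  1 - 2 * C * l + C ^+ 2 * (l ^+ 2 + tau / k%:R).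

(** Bounding the dispersion by its multiple of the energy leaves a difference to
    which [spectral_ge0] applies; the polynomial there is q - step_factor. *)
Lemma step_mean_le C q v :
  (forall j, (1 <= j <= m)%N ->
     step_factor (sup dispersion_quotients) C (lambda j) <= q) ->
  step_mean C v <= q * qform A v.
Proof.
set t := sup _ => leq; rewrite step_meanE.
have Ck : 0 <= C ^+ 2 / k%:R by rewrite divr_ge0// sqr_ge0.
have := ler_wpM2l Ck (dispersion_le_sup v); rewrite -/t.
have := @spectral_ge0 _ _ A lambda As Alambda
  (q - 1 - C ^+ 2 / k%:R * t) (2 * C) (- C ^+ 2) v.
have h j : (1 <= j <= m)%N ->
    0 <= q - 1 - C ^+ 2 / k%:R * t + 2 * C * lambda j
         + - C ^+ 2 * lambda j ^+ 2.
  by move/leq; rewrite -subr_ge0 /step_factor; congr (_ <= _); ring.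
by move=> /(_ h); lra.
Qed.

Lemma step_mean_ge C q v :
  (forall j, (1 <= j <= m)%N ->
     q <= step_factor (inf dispersion_quotients) C (lambda j)) ->
  q * qform A v <= step_mean C v.
Proof.
set s := inf _ => leq; rewrite step_meanE.
have Ck : 0 <= C ^+ 2 / k%:R by rewrite divr_ge0// sqr_ge0.
have := ler_wpM2l Ck (inf_le_dispersion v); rewrite -/s.
have := @spectral_ge0 _ _ A lambda As Alambda
  (1 - q + C ^+ 2 / k%:R * s) (- (2 * C)) (C ^+ 2) v.
have h j : (1 <= j <= m)%N ->
    0 <= 1 - q + C ^+ 2 / k%:R * s + - (2 * C) * lambda j
         + C ^+ 2 * lambda j ^+ 2.
  by move/leq; rewrite -subr_ge0 /step_factor; congr (_ <= _); ring.
by move=> /(_ h); lra.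
Qed.

End step_mean.

(** * Step-size thresholds *)

Section step_sizes.
Context {R : realType}.

Lemma uniform_margin m (f : nat -> R) :
  (forall j, (1 <= j <= m)%N -> 0 < f j) ->
  exists2 eps, 0 < eps & forall j, (1 <= j <= m)%N -> eps <= f j.
Proof.
elim: m => [_|m IH f_gt0].
  by exists 1 => // j; case: j => //= j; rewrite ltn0.
have [j /andP[j1 jm]|eps eps0 le_eps] := IH; first by rewrite f_gt0// j1 ltnW.
exists (Num.min eps (f m.+1)) => [|j /andP[j1]].
  by rewrite lt_min eps0 f_gt0//= leqnn.
rewrite leq_eqVlt => /orP[/eqP->|jm]; first by rewrite ge_min lexx orbT.
by rewrite ge_min le_eps// j1.
Qed.

Lemma uniform_bound m (f : nat -> R) :
  exists2 K, 0 <= K & forall j, (1 <= j <= m)%N -> f j <= K.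
Proof.
elim: m => [|m [K K0 leK]].
  by exists 0 => // j; case: j => //= j; rewrite ltn0.
exists (Num.max K (f m.+1)) => [|j /andP[j1]]; first by rewrite le_max K0.
rewrite leq_eqVlt => /orP[/eqP->|jm]; first by rewrite le_max lexx orbT.
by rewrite le_max leK// j1.
Qed.

(** Clearing denominators, the difference of the two sides is a positive
    multiple of (a - b) (a b - sigma). *)
Lemma threshold_le (a b sigma : R) : 0 < a -> 0 < b -> 0 <= sigma ->
  0 <= (a - b) * (a * b - sigma) ->
  2 * a / (a ^+ 2 + sigma) <= 2 * b / (b ^+ 2 + sigma).
Proof.
move=> a0 b0 s0 h.
have den x : 0 < x -> 0 < x ^+ 2 + sigma.
  by move=> ?; rewrite ltr_wpDr// exprn_gt0.
by rewrite ler_pdivrMr ?den// mulrAC ler_pdivlMr ?den//; nra.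
Qed.

Variables (lambda : nat -> R) (m k : nat) (tau : R).
Hypotheses (k0 : (0 < k)%N) (tau0 : 0 <= tau).
Hypothesis lambda_mono :
  forall i j, (1 <= i)%N -> (i <= j <= m)%N -> lambda j <= lambda i.
Hypothesis lambda_gt0 : forall i, (1 <= i <= m)%N -> 0 < lambda i.

Let kR : 0 < k%:R :> R. Proof. by rewrite ltr0n. Qed.
Let tauk : 0 <= tau / k%:R. Proof. by rewrite divr_ge0. Qed.

Lemma step_threshold_gt0 i : (1 <= i <= m)%N ->
  0 < step_threshold lambda k tau i.
Proof.
move=> /lambda_gt0 l0; rewrite divr_gt0// ?mulr_gt0//.
by rewrite ltr_wpDr// exprn_gt0.
Qed.

(** The threshold is unimodal in the eigenvalue, so its minimum over the
    spectrum is at one of the ends; the case distinction on k compares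
    the two ends. *)
Lemma convergence_bound_le i : (1 <= i <= m)%N ->
  convergence_bound lambda m k tau <= step_threshold lambda k tau i.
Proof.
move=> im; have /andP[i1 lim] := im; have m1 := leq_trans i1 lim.
have l1 : 0 < lambda 1%N by rewrite lambda_gt0//= m1.
have lm : 0 < lambda m by rewrite lambda_gt0//= m1 leqnn.
have li := lambda_gt0 im.
have i_le1 : lambda i <= lambda 1%N by rewrite lambda_mono// i1.
have m_lei : lambda m <= lambda i by rewrite lambda_mono// lim leqnn.
have l1m : 0 < lambda 1%N * lambda m by rewrite mulr_gt0.
rewrite /convergence_bound; case: ifPn => [|].
  rewrite ltr_pdivrMr// mulrC -ltr_pdivrMr// => lt_tau.
  apply: threshold_le => //; apply: mulr_ge0; rewrite subr_ge0//.
  by rewrite (le_trans (ltW lt_tau))// ler_pM2l.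
rewrite -leNgt ler_pdivlMr// mulrC -ler_pdivlMr// => le_tau.
apply: threshold_le => //; apply: mulr_le0; rewrite subr_le0//.
by rewrite (le_trans _ le_tau)// mulrC ler_pM2r.
Qed.

(** For i < j the product lambda i * lambda j is at least
    lambda (j - 1) * lambda j, and for i > j it is at most
    lambda j * lambda (j + 1); the conditions on j place tau / k between these
    two bounds, which is what [threshold_le] needs in both cases. *)
Lemma divergence_index_max i j : (1 <= i <= m)%N ->
  divergence_index lambda m k tau j ->
  step_threshold lambda k tau i <= step_threshold lambda k tau j.
Proof.
move=> im ind; have /andP[i1 lim] := im; have m1 := leq_trans i1 lim.
have jm : (1 <= j <= m)%N.
  case: ind => [[-> _]|[/andP[j2 jm] _]|[-> _]].
  - by rewrite m1.
  - by rewrite (ltnW j2) (leq_trans jm (leq_pred _)).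
  - by rewrite m1 leqnn.
have /andP[j1 ljm] := jm; have li := lambda_gt0 im; have lj := lambda_gt0 jm.
have below : (i < j)%N -> tau / k%:R <= lambda j * lambda j.-1.
  move=> ij; have lj1 : 0 < lambda j.-1 by apply: lambda_gt0; lia.
  have jj : 0 < lambda j * lambda j.-1 by rewrite mulr_gt0.
  rewrite ler_pdivrMr// mulrC -ler_pdivrMr//; apply: ltW.
  case: ind => [[j1E _]|[_ /andP[]//]|[jE]].
    by move: ij; rewrite j1E; lia.
  by rewrite -jE => h; apply: h; lia.
have above : (j < i)%N -> lambda j.+1 * lambda j <= tau / k%:R.
  move=> ji; have lj1 : 0 < lambda j.+1 by apply: lambda_gt0; lia.
  have jj : 0 < lambda j.+1 * lambda j by rewrite mulr_gt0.
  rewrite ler_pdivlMr// mulrC -ler_pdivlMr//.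
  case: ind => [[jE]|[_ /andP[]//]|[jE _]]; last by move: ji; rewrite jE; lia.
  by rewrite jE (mulrC (lambda 2%N)) => h; apply: h; lia.
apply: threshold_le => //.
have [ij|ji|->] := ltngtP i j; last by rewrite subrr mul0r.
  apply: mulr_ge0; rewrite subr_ge0; first by rewrite lambda_mono// ltnW.
  rewrite (le_trans (below ij))// mulrC ler_pM2r// lambda_mono//; lia.
apply: mulr_le0; rewrite subr_le0; first by rewrite lambda_mono// ltnW.
rewrite (le_trans _ (above ji))// ler_pM2r// lambda_mono//; lia.
Qed.

Let threshold_den i : (1 <= i <= m)%N -> 0 < lambda i ^+ 2 + tau / k%:R.
Proof. by move=> /lambda_gt0 l0; rewrite ltr_wpDr// exprn_gt0. Qed.

Lemma step_factor_lt1 c i : (1 <= i <= m)%N ->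
  0 < c -> c < step_threshold lambda k tau i ->
  step_factor k tau c (lambda i) < 1.
Proof.
move=> im c0; rewrite /step_threshold ltr_pdivlMr ?threshold_den//.
by rewrite -(ltr_pM2l c0) /step_factor; lra.
Qed.

(** The decrease is c (2 l - c (l^2 + tau / k)), a product of two quantities
    that are at least delta and delta (l^2 + tau / k). *)
Lemma step_factor_le_margin c delta i : (1 <= i <= m)%N -> 0 < delta ->
  delta <= c -> c <= step_threshold lambda k tau i - delta ->
  step_factor k tau c (lambda i) <= 1 - delta ^+ 2 * lambda i ^+ 2.
Proof.
move=> im delta0 delta_c; have den := threshold_den im.
rewrite /step_threshold /step_factor lerBrDr ler_pdivlMr//.
move: den tauk; set sigma := tau / k%:R => den sigma0 upper.
have h1 : c * ((c + delta) * (lambda i ^+ 2 + sigma)) <= c * (2 * lambda i).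
  by rewrite ler_pM2l// (lt_le_trans delta0).
have h2 : delta * delta * (lambda i ^+ 2 + sigma)
          <= c * delta * (lambda i ^+ 2 + sigma).
  by rewrite ler_pM2r// ler_pM2r.
have h3 : 0 <= delta * delta * sigma by rewrite !mulr_ge0// ltW.
lra.
Qed.

Lemma step_factor_gt1 c i : (1 <= i <= m)%N ->
  c < 0 \/ step_threshold lambda k tau i < c ->
  1 < step_factor k tau c (lambda i).
Proof.
move=> im; have den := threshold_den im; have li := lambda_gt0 im.
rewrite /step_factor; case=> [c0|ci].
  have := mulr_gt0 (mulr_gt0 (ltr0n _ 2) li) (_ : 0 < - c); rewrite oppr_gt0.
  have := mulr_ge0 (sqr_ge0 c) (ltW den).
  by move=> h1 /(_ c0); lra.
have c0 := lt_trans (step_threshold_gt0 im) ci.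
have : c * (2 * lambda i) < c * (c * (lambda i ^+ 2 + tau / k%:R)).
  by rewrite ltr_pM2l// -ltr_pdivrMr.
lra.
Qed.

End step_sizes.

(** * Measurability of matrix-valued functions *)

Section measurable_matrix.
Context d (T : measurableType d) (R : realType).

Lemma measurable_mx_entry m n (f : T -> 'M[R]_(m, n)) i j :
  measurable_fun setT f -> measurable_fun setT (fun w => f w i j).
Proof.
move=> mf; have me : measurable_fun setT (fun M : 'M[R]_(m, n) => M i j).
  move=> _ B mB; apply: sub_sigma_algebra.
  by exists (i, j) => //; exists B.
exact: (measurableT_comp me mf).
Qed.

Lemma measurable_mx m n (f : T -> 'M[R]_(m, n)) :
  (forall i j, measurable_fun setT (fun w => f w i j)) -> measurable_fun setT f.
Proof.
move=> mf; apply: measurability; first by [].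
move=> _ [_ [[i j] _ [B mB <-]] <-].
by have := mf i j measurableT B mB; rewrite !setTI.
Qed.

Lemma measurable_mxD m n (f g : T -> 'M[R]_(m, n)) :
  measurable_fun setT f -> measurable_fun setT g ->
  measurable_fun setT (fun w => f w + g w).
Proof.
move=> mf mg; apply: measurable_mx => i j.
rewrite (_ : (fun _ => _) = (fun w => f w i j) \+ (fun w => g w i j)).
  by apply: measurable_funD; exact: measurable_mx_entry.
by apply/funext => w; rewrite mxE.
Qed.

Lemma measurable_mxM m n q (f : T -> 'M[R]_(m, n)) (g : T -> 'M[R]_(n, q)) :
  measurable_fun setT f -> measurable_fun setT g ->
  measurable_fun setT (fun w => f w *m g w).
Proof.
move=> mf mg; apply: measurable_mx => i j.
rewrite (_ : (fun _ => _) = (fun w => \sum_a f w i a * g w a j)).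
  apply: measurable_sum => a.
  by apply: measurable_funM; exact: measurable_mx_entry.
by apply/funext => w; rewrite mxE.
Qed.

Lemma measurable_mxZ m n (c : R) (f : T -> 'M[R]_(m, n)) :
  measurable_fun setT f -> measurable_fun setT (fun w => c *: f w).
Proof.
move=> mf; apply: measurable_mx => i j.
rewrite (_ : (fun _ => _) = cst c \* (fun w => f w i j)).
  by apply: measurable_funM => //; exact: measurable_mx_entry.
by apply/funext => w; rewrite mxE.
Qed.

Lemma measurable_mxB m n (f g : T -> 'M[R]_(m, n)) :
  measurable_fun setT f -> measurable_fun setT g ->
  measurable_fun setT (fun w => f w - g w).
Proof.
move=> mf mg; under eq_fun do rewrite -scaleN1r.
by apply: measurable_mxD => //; exact: measurable_mxZ.
Qed.

Lemma measurable_mx_tr m n (f : T -> 'M[R]_(m, n)) :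
  measurable_fun setT f -> measurable_fun setT (fun w => (f w)^T).
Proof.
move=> mf; apply: measurable_mx => i j.
rewrite (_ : (fun _ => _) = (fun w => f w j i)).
  exact: measurable_mx_entry.
by apply/funext => w; rewrite mxE.
Qed.

Lemma measurable_mx_sum (I : eqType) (s : seq I) m n
    (f : I -> T -> 'M[R]_(m, n)) :
  (forall i, i \in s -> measurable_fun setT (f i)) ->
  measurable_fun setT (fun w => \sum_(i <- s) f i w).
Proof.
elim: s => [|i s IH] mf.
  by under eq_fun do rewrite big_nil; exact: measurable_cst.
under eq_fun do rewrite big_cons.
apply: measurable_mxD; first by apply: mf; rewrite mem_head.
by apply: IH => j js; apply: mf; rewrite in_cons js orbT.
Qed.

Lemma measurable_bform p (f : T -> 'M[R]_p) (g h : T -> 'cV[R]_p) :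
  measurable_fun setT f -> measurable_fun setT g -> measurable_fun setT h ->
  measurable_fun setT (fun w => bform (f w) (g w) (h w)).
Proof.
move=> mf mg mh; apply: measurable_mx_entry.
by apply: measurable_mxM mh; apply: measurable_mxM mf; exact: measurable_mx_tr.
Qed.

Lemma measurable_qform p (A : 'M[R]_p) (g : T -> 'cV[R]_p) :
  measurable_fun setT g -> measurable_fun setT (fun w => qform A (g w)).
Proof. by move=> mg; exact: (measurable_bform (measurable_cst A) mg mg). Qed.

End measurable_matrix.

(** * Real random variables with a prescribed mean *)

Section has_mean.
Context d (T : measurableType d) (R : realType) (P : probability T R).
Implicit Types (f g : T -> R) (a b : R).

(** Integrability travels with the value, so that the mean of a linear
    combination follows from the calculus below without side conditions. *)
Definition has_mean f a : Prop :=
  P.-integrable setT (EFin \o f) /\ (\int[P]_w (f w)%:E = a%:E)%E.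

Lemma has_mean_fine f : P.-integrable setT (EFin \o f) ->
  has_mean f (fine 'E_P[f]).
Proof.
move=> fi; split=> //; rewrite unlock fineK//.
exact: (integrable_fin_num measurableT fi).
Qed.

Lemma has_mean_cst a : has_mean (fun=> a) a.
Proof.
split; first exact: finite_measure_integrable_cst.
by rewrite integral_cst//= probability_setT mule1.
Qed.

Lemma has_meanD f g a b : has_mean f a -> has_mean g b ->
  has_mean (fun w => f w + g w) (a + b).
Proof.
move=> [fi fE] [gi gE]; split; first exact: (integrableD measurableT fi gi).
by rewrite EFinD -fE -gE -integralD.
Qed.

Lemma has_meanZ f a b : has_mean f a -> has_mean (fun w => b * f w) (b * a).
Proof.
move=> [fi fE]; split; first exact: (integrableZl measurableT b fi).
by rewrite EFinM -fE -integralZl.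
Qed.

Lemma has_mean_sum (I : Type) (s : seq I) (f : I -> T -> R) (a : I -> R) :
  (forall i, has_mean (f i) (a i)) ->
  has_mean (fun w => \sum_(i <- s) f i w) (\sum_(i <- s) a i).
Proof.
move=> fa; elim: s => [|i s IH].
  by rewrite big_nil; under eq_fun do rewrite big_nil; exact: has_mean_cst.
by rewrite big_cons; under eq_fun do rewrite big_cons; exact: has_meanD.
Qed.

Lemma has_mean_ae f g a : measurable_fun setT g ->
  {ae P, forall w, f w = g w} -> has_mean f a -> has_mean g a.
Proof.
move=> mg fg [fi fE]; have /integrableP[mf fint] := fi.
have mg' : measurable_fun setT (EFin \o g) by exact/measurable_EFinP.
split.
  apply/integrableP; split => //; rewrite (le_lt_trans _ fint)//.
  rewrite le_eqVlt; apply/orP; left; apply/eqP.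
  apply: ae_eq_integral => //.
  - exact: measurableT_comp.
  - exact: measurableT_comp.
  - by apply: filterS fg => w /= -> _.
rewrite -fE; apply: ae_eq_integral => //.
by apply: filterS fg => w /= -> _.
Qed.

Lemma has_mean_unique f a b : has_mean f a -> has_mean f b -> a = b.
Proof. by move=> [_ fa] [_]; rewrite fa => -[]. Qed.

Lemma has_mean_ge0 f a : {ae P, forall w, 0 <= f w} -> has_mean f a -> 0 <= a.
Proof.
move=> f0 [fi fE].
have /integrableP[/measurable_EFinP mf _] := fi.
have h : has_mean (fun w => `|f w|) a.
  apply: has_mean_ae (conj fi fE); first exact: measurableT_comp.
  by apply: filterS f0 => w fw; rewrite ger0_norm.
by rewrite -lee_fin -h.2; apply: integral_ge0 => w _; rewrite lee_fin.
Qed.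

Lemma has_mean0_ae f : {ae P, forall w, 0 <= f w} -> has_mean f 0 ->
  {ae P, forall w, f w = 0}.
Proof.
move=> f0 [fi fE]; have /integrableP[mf _] := fi.
have : (\int[P]_w `|(EFin \o f) w| = 0)%E.
  rewrite -[RHS]fE; apply: ae_eq_integral => //; first exact: measurableT_comp.
  by apply: filterS f0 => w fw _ /=; rewrite ger0_norm.
move=> /(ae_eq_integral_abs P measurableT mf).
by apply: filterS => w /(_ I)[].
Qed.

Lemma has_mean_bform p (X : T -> 'M[R]_p) u v : mx_integrable P X ->
  has_mean (fun w => bform (X w) u v) (bform (mx_mean P X) u v).
Proof.
move=> Xi; rewrite bform_sum; under eq_fun do rewrite bform_sum.
apply: has_mean_sum => i; apply: has_mean_sum => j; apply: has_meanZ.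
by rewrite mxE; exact: has_mean_fine.
Qed.

Lemma mx_mean_sym p (X : T -> 'M[R]_p) : mx_integrable P X ->
  {ae P, forall w, (X w)^T = X w} -> (mx_mean P X)^T = mx_mean P X.
Proof.
move=> Xi Xs; apply/matrixP => i j; rewrite !mxE.
apply: (@has_mean_unique (fun w => X w i j)); last exact: has_mean_fine.
apply: has_mean_ae (has_mean_fine (Xi j i)).
  by have /integrableP[/measurable_EFinP] := Xi i j.
by apply: filterS Xs => w Xw; rewrite -[in RHS]Xw mxE.
Qed.

End has_mean.

(** * Moments of the quadratic problem *)

Section quadratic_problem_moments.
Context d (T : measurableType d) (R : realType) (P : probability T R) (p : nat).
Variables (Q : {RV P >-> 'M[R]_p}) (r : {RV P >-> 'cV[R]_p}).
Hypothesis qp : quadratic_problem P Q r.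

Definition mean_mx : 'M[R]_p := mx_mean P Q.
Definition mean_sandwich : 'M[R]_p :=
  mx_mean P (fun w => Q w *m mean_mx *m Q w).

Let A := mean_mx.
Let B := mean_sandwich.

Lemma mean_mx_sym : A^T = A.
Proof.
apply: mx_mean_sym; first exact: qp_EQ qp.
by apply: filterS (qp_psd qp) => w [].
Qed.

Lemma mean_mx_psd : psd A.
Proof.
split=> [|v]; first exact: mean_mx_sym.
apply: has_mean_ge0 (has_mean_bform v v (qp_EQ qp)).
by apply: filterS (qp_psd qp) => w [_]; apply.
Qed.

Lemma mean_sandwich_sym : B^T = B.
Proof.
apply: mx_mean_sym; first exact: qp_EQEQQ qp.
apply: filterS (qp_psd qp) => w [Qs _].
by rewrite !trmx_mul Qs mean_mx_sym mulmxA.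
Qed.

(** The nonnegative variable v^T Q v has mean v^T A v = 0, so it vanishes almost
    surely. *)
Lemma mean_mx_ker_ae (v : 'cV[R]_p) :
  A *m v = 0 -> {ae P, forall w, Q w *m v = 0}.
Proof.
move=> Av0; have mean0 : has_mean P (fun w => qform (Q w) v) 0.
  have := has_mean_bform v v (qp_EQ qp).
  by rewrite -/mean_mx -/A [bform A v v]/bform -mulmxA Av0 mulmx0 mxE.
have ge0 : {ae P, forall w, 0 <= qform (Q w) v}.
  by apply: filterS (qp_psd qp) => w [_]; apply.
apply: filterS2 (qp_psd qp) (has_mean0_ae ge0 mean0) => w.
exact: psd_qform_eq0.
Qed.

Lemma mean_sandwich_ker (v : 'cV[R]_p) : A *m v = 0 -> B *m v = 0.
Proof.
move=> /mean_mx_ker_ae Qv0; apply/colP => i; rewrite [RHS]mxE.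
have -> : (B *m v) i 0 = bform B (delta_mx i 0) v.
  by rewrite /bform trmx_delta -mulmxA -rowE [RHS]mxE.
apply: has_mean_unique (has_mean_bform (delta_mx i 0) v (qp_EQEQQ qp)) _.
apply: has_mean_ae (has_mean_cst P 0).
  apply: measurable_bform; [|exact: measurable_cst|exact: measurable_cst].
  have mQ := measurable_funPT Q.
  apply: measurable_mxM mQ.
  by apply: measurable_mxM; last exact: measurable_cst.
by apply: filterS Qv0 => w Qv; rewrite /bform -!mulmxA Qv !mulmx0 mxE.
Qed.

(** Expanding the square leaves only Q and Q A Q, the two matrices whose means
    are known; no higher moment of Q enters. *)
Lemma has_mean_sample_step (h v : 'cV[R]_p) (c : R) :
  has_mean P (fun w => qform A (h - c *: (Q w *m v)))
    (qform A h - 2 * c * bform A h (A *m v) + c ^+ 2 * qform B v).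
Proof.
have mQ := measurable_funPT Q.
have ->: bform A h (A *m v) = bform A (A *m h) v.
  by rewrite /bform trmx_mul mean_mx_sym !mulmxA.
have := has_meanD (has_meanD (has_mean_cst P (qform A h))
  (has_meanZ (- (2 * c)) (has_mean_bform (A *m h) v (qp_EQ qp))))
  (has_meanZ (c ^+ 2) (has_mean_bform v v (qp_EQEQQ qp))).
rewrite mulNr; apply: has_mean_ae.
  apply: measurable_qform; apply: measurable_mxB; first exact: measurable_cst.
  by apply: measurable_mxZ; apply: measurable_mxM; last exact: measurable_cst.
apply: filterS (qp_psd qp) => w [Qs _].
rewrite qform_comb ?mean_mx_sym//.
have -> : bform A h (Q w *m v) = bform (Q w) (A *m h) v.
  by rewrite /bform trmx_mul mean_mx_sym !mulmxA.
rewrite -qform_mul Qs -/mean_mx -/A !qformE; ring.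
Qed.

(** The dispersion is the mean of the A-energy of A v - Q v. *)
Lemma mean_dispersion_ge0 v : 0 <= dispersion A B v.
Proof.
have := has_mean_sample_step (A *m v) v 1.
rewrite -qformE -(qform_expS2 v 1 mean_mx_sym) expr1n mulr1 mul1r.
rewrite (_ : _ - _ + _ = dispersion A B v); last by rewrite /dispersion; ring.
by apply: has_mean_ge0; apply: aeW => w; have [_] := mean_mx_psd; apply.
Qed.

Lemma homogeneous_solution_ae thetas : homogeneous_solution P Q r thetas ->
  {ae P, forall w, Q w *m thetas + r w = 0}.
Proof.
move=> [_ argmin]; apply: filterS2 (qp_psd qp) argmin => w [Qs _].
exact: argmin_stationary.
Qed.

End quadratic_problem_moments.

(** * Independence of a sample from the past *)

Section past_events.
Context d (T : measurableType d) (R : realType) (P : probability T R).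
Context d' (U : measurableType d').
Variable X : nat -> T -> U.
Hypothesis mX : forall j, measurable_fun setT (X j).
Hypothesis X_indep : mutually_independent P X.
Local Open Scope ereal_scope.

(** The generators run over all the indices below n at once, which makes them
    stable under intersection, as a pi-system must be. *)
Definition past_cylinders n : set (set T) :=
  [set E | exists2 B : nat -> set U, forall j, measurable (B j) &
     E = \bigcap_(j in [set` iota 0 n]) (X j @^-1` B j)].

Lemma past_cylindersI n : setI_closed (past_cylinders n).
Proof.
move=> _ _ [B mB ->] [C mC ->]; exists (fun j => B j `&` C j).
  by move=> j; exact: measurableI.
by rewrite -bigcapI; apply: eq_bigcapr => j _; rewrite preimage_setI.
Qed.

Let mXpre j B : measurable B -> measurable (X j @^-1` B).
Proof. by move=> mB; rewrite -[_ @^-1` _]setTI; exact: mX. Qed.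

Lemma past_cylinder_independent n E D : past_cylinders n E -> measurable D ->
  P (E `&` X n @^-1` D) = P E * P (X n @^-1` D).
Proof.
move=> [B mB ->] mD.
pose B' j := if j == n then D else B j.
have mB' j : measurable (B' j) by rewrite /B'; case: ifP.
have eqB j : j \in iota 0 n -> B' j = B j.
  rewrite mem_iota add0n /B' => /andP[_].
  by case: eqVneq => // ->; rewrite ltnn.
have := X_indep (iota_uniq 0 n.+1) mB'.
rewrite -addn1 iotaD add0n big_cat /= big_seq1.
rewrite (_ : \bigcap_(j in _) _ =
    \bigcap_(j in [set` iota 0 n]) (X j @^-1` B j) `&` X n @^-1` D).
  move=> ->; rewrite [B' n]/B' eqxx (X_indep (iota_uniq 0 n) mB); congr (_ * _).
  by rewrite big_seq [RHS]big_seq; apply: eq_bigr => j /eqB ->.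
apply/seteqP; split=> [w h|w [h hn] j /=].
  split=> [j /= jn|]; last first.
    by have := h n; rewrite /= mem_cat mem_seq1 eqxx orbT /B' eqxx => /(_ isT).
  by have := h j; rewrite /= mem_cat jn eqB// => /(_ isT).
rewrite mem_cat mem_seq1 => /orP[jn|/eqP->]; first by rewrite eqB//; exact: h.
by rewrite /B' eqxx.
Qed.

Lemma past_cylinders_measurable n E : past_cylinders n E -> measurable E.
Proof.
move=> [B mB ->]; rewrite bigcap_seq; apply: big_ind => //.
- exact: measurableI.
- by move=> j _; exact: mXpre.
Qed.

(** For a fixed D the events E with the product formula form a lambda-system,
    which contains the pi-system of cylinders. *)
Lemma past_independent n E D : <<s past_cylinders n >> E -> measurable D ->
  P (E `&` X n @^-1` D) = P E * P (X n @^-1` D).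
Proof.
move=> pastE mD.
have mZ := mXpre n mD; set Z := X n @^-1` D in mZ *.
suff /(_ _ pastE)[] : <<s past_cylinders n >> `<=`
   [set E | measurable E /\ P (E `&` Z) = P E * P Z] by [].
apply: lambda_system_subset => //.
- exact: past_cylindersI.
- apply/dynkin_lambda_system; split.
  + by rewrite /= setTI probability_setT mul1e.
  + move=> F [mF FZ]; split; first exact: measurableC.
    rewrite setIC -setDE measureD//; last by rewrite ltey_eq fin_num_measure.
    rewrite [Z `&` F]setIC.
    transitivity (P Z - P F * P Z); first by rewrite -FZ.
    by rewrite probability_setC// muleBl ?mul1e// fin_num_measure.
  + move=> F tF mFZ; have mF n' := (mFZ n').1.
    split; first exact: bigcupT_measurable.
    rewrite setI_bigcupl measure_semi_bigcup//.
    * rewrite measure_semi_bigcup//; last exact: bigcupT_measurable.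
      rewrite -[P Z]fineK ?fin_num_measure// muleC -nneseriesZl//.
      apply: eq_eseriesr => i _.
      transitivity (P (F i) * P Z); first exact: (mFZ i).2.
      by rewrite muleC fineK ?fin_num_measure.
    * by move=> i; exact: measurableI.
    * exact: trivIset_setIr.
    * by apply: bigcupT_measurable => i; exact: measurableI.
- move=> F cF; split; first exact: past_cylinders_measurable cF.
  exact: past_cylinder_independent.
Qed.

(** The past is a sigma-algebra on T coarser than the given one.  Taken as the
    measurable structure of the source, it makes the general measurability
    lemmas prove that a function depends on the past only. *)
Lemma past_measurable n j : (j < n)%N ->
  @measurable_fun _ _ (g_sigma_algebraType (past_cylinders n)) U setT (X j).
Proof.
move=> jn _ B mB; rewrite setTI; apply: sub_sigma_algebra.
exists (fun i => if i == j then B else setT) => [i|]; first by case: ifP.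
apply/seteqP; split=> [w Bw i _ /=|w /(_ j)/=]; first by case: eqVneq => // ->.
by rewrite eqxx mem_iota /= add0n jn; exact.
Qed.

End past_events.

Section independent_integral.
Context d (T : measurableType d) (R : realType) (P : probability T R).
Context d1 (V : measurableType d1) d2 (U : measurableType d2).
Local Open Scope ereal_scope.

(** Independence says that the joint law of S and Z is the product of the laws,
    so Tonelli's theorem applies; Y only matters through its law. *)
Lemma integral_independent (S : {RV P >-> V}) (Z Y : {RV P >-> U})
    (f : V * U -> \bar R) :
  (forall A B, measurable A -> measurable B ->
     P (S @^-1` A `&` Z @^-1` B) = P (S @^-1` A) * P (Z @^-1` B)) ->
  eq_law P Z Y -> measurable_fun setT f -> (forall x, 0 <= f x) ->
  \int[P]_w f (S w, Z w) = \int[P]_w \int[P]_w' f (S w, Y w').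
Proof.
move=> SZ ZY mf f0.
have mSZ : measurable_fun setT (fun w => (S w, Z w)).
  by apply: measurable_fun_pair; exact: measurable_funPT.
pose SZ_RV : {RV P >-> (V * U)%type} :=
  HB.pack (fun w => (S w, Z w)) (isMeasurableFun.Build _ _ _ _ _ mSZ).
transitivity (\int[distribution P SZ_RV]_x f x).
  by rewrite ge0_integral_distribution.
transitivity (\int[distribution P S \x distribution P Y]_x f x).
  apply: eq_measure_integral => A mA _; apply/esym.
  apply: product_measure_unique => // B C mB mC.
  rewrite /= /distribution /pushforward /=.
  rewrite -(ZY C mC) -SZ//; congr (P _).
rewrite fubini_tonelli1// ge0_integral_distribution//.
- apply: eq_integral => w _ /=; rewrite /fubini_F ge0_integral_distribution//.
  exact: measurableT_comp (measurable_pair1 _).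
- exact: measurable_fun_fubini_tonelli_F.
- by move=> x; apply: integral_ge0.
Qed.

End independent_integral.

(** * Energy within a batch *)

Section batch_energy.
Context d (T : measurableType d) (R : realType) (P : probability T R) (p : nat).
Variables (Q : {RV P >-> 'M[R]_p}) (r : {RV P >-> 'cV[R]_p}).
Hypothesis qp : quadratic_problem P Q r.
Let A := mean_mx Q.
Let B := mean_sandwich Q.

(** The mean final energy when the batch was started at the error a, the current
    partial update is b, and l samples, each weighted by c, are still to come:
    the l steps move b by l c A a on average, and each of them adds the variance
    c^2 times the dispersion at a. *)
Definition batch_energy (c : R) (l : nat) (a b : 'cV[R]_p) : R :=
  qform A (b - (l%:R * c) *: (A *m a)) + l%:R * c ^+ 2 * dispersion A B a.

Lemma batch_energy_ge0 c l a b : 0 <= batch_energy c l a b.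
Proof.
apply: addr_ge0; first by have [_] := mean_mx_psd qp; apply.
by rewrite mulr_ge0 ?(mean_dispersion_ge0 qp)// mulr_ge0// sqr_ge0.
Qed.

Lemma batch_energy0 c a b : batch_energy c 0 a b = qform A b.
Proof. by rewrite /batch_energy !mul0r scale0r subr0 addr0. Qed.

Lemma batch_energy_full k C a : (0 < k)%N ->
  batch_energy (C / k%:R) k a a = step_mean A B k C a.
Proof.
move=> k0; have kN0 : k%:R != 0 :> R by rewrite pnatr_eq0 -lt0n.
rewrite /batch_energy /step_mean mulrC divfK//; congr (_ + _ * _).
by field.
Qed.

(** One more sample is averaged out.  The step of the recursion closes because
    c^2 (a^T B a) splits into c^2 (a^T A^3 a), which completes the square of the
    mean step, and c^2 times the dispersion. *)
Lemma has_mean_batch_energy c l a b :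
  has_mean P (fun w => batch_energy c l a (b - c *: (Q w *m a)))
    (batch_energy c l.+1 a b).
Proof.
have As := mean_mx_sym qp.
have -> : batch_energy c l.+1 a b =
    (qform A (b - (l%:R * c) *: (A *m a))
     - 2 * c * bform A (b - (l%:R * c) *: (A *m a)) (A *m a)
     + c ^+ 2 * qform B a)
    + l%:R * c ^+ 2 * dispersion A B a.
  rewrite /batch_energy -[l.+1%:R]natr1.
  rewrite (_ : b - ((l%:R + 1) * c) *: (A *m a) =
               b - (l%:R * c) *: (A *m a) - c *: (A *m a)); last first.
    by rewrite mulrDl mul1r scalerDl opprD addrA.
  rewrite (qform_comb _ _ _ As) /dispersion (qform_expS2 a 1 As) expr1; ring.
rewrite /batch_energy.
under eq_fun do rewrite addrAC.
exact: has_meanD (has_mean_sample_step qp _ _ _) (has_mean_cst P _).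
Qed.

Lemma measurable_batch_energy d' (T' : measurableType d') c l
    (a b : T' -> 'cV[R]_p) :
  measurable_fun setT a -> measurable_fun setT b ->
  measurable_fun setT (fun w => batch_energy c l (a w) (b w)).
Proof.
move=> ma mb; apply: measurable_funD.
  apply: measurable_qform; apply: measurable_mxB => //.
  by apply: measurable_mxZ; apply: measurable_mxM.
apply: measurable_funM; first exact: measurable_cst.
by apply: measurable_funB; exact: measurable_qform.
Qed.

End batch_energy.

(** * The iterates *)

Section sgd_dynamics.
Context {R : realType} (p : nat) (k : nat) (C : nat -> R) (theta0 : 'cV[R]_p).

(** Only the samples that the iterate uses have to be measurable, and the
    sigma-algebra on the source is arbitrary: the lemma serves for the whole
    probability space and for the past of a sample alike. *)
Lemma measurable_sgd d (T : measurableType d) (Qs : nat -> T -> 'M[R]_p)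
    (rs : nat -> T -> 'cV[R]_p) N :
  (forall j, (j <= N * k)%N -> measurable_fun setT (Qs j)) ->
  (forall j, (j <= N * k)%N -> measurable_fun setT (rs j)) ->
  measurable_fun setT (sgd Qs rs k C theta0 N).
Proof.
elim: N => [|N IH] mQs mrs; first exact: measurable_cst.
have mN : measurable_fun setT (sgd Qs rs k C theta0 N).
  apply: IH => j jN; [apply: mQs|apply: mrs];
    by rewrite (leq_trans jN)// leq_mul.
apply: measurable_mxB => //; apply: measurable_mxZ.
apply: measurable_mx_sum => j; rewrite mem_index_iota ltnS => /andP[_ jN].
by apply: measurable_mxD (mrs _ jN); apply: measurable_mxM mN; exact: mQs.
Qed.

(** The N-th update after only the first i samples of its batch; the gradients
    are all taken at the N-th iterate. *)
Definition batch_state (T : Type) (Qs : nat -> T -> 'M[R]_p)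
    (rs : nat -> T -> 'cV[R]_p) N i (w : T) : 'cV[R]_p :=
  let th := sgd Qs rs k C theta0 N w in
  th - (C N.+1 / k%:R) *:
    \sum_((N * k).+1 <= j < (N * k).+1 + i) (Qs j w *m th + rs j w).

Lemma batch_state0 T Qs rs N (w : T) :
  batch_state Qs rs N 0 w = sgd Qs rs k C theta0 N w.
Proof. by rewrite /batch_state addn0 big_geq// scaler0 subr0. Qed.

Lemma batch_stateS T Qs rs N i (w : T) :
  let n := ((N * k).+1 + i)%N in let th := sgd Qs rs k C theta0 N w in
  batch_state Qs rs N i.+1 w =
  batch_state Qs rs N i w - (C N.+1 / k%:R) *: (Qs n w *m th + rs n w).
Proof.
move=> n th; rewrite /batch_state addnS big_nat_recr/= ?leq_addr//.
by rewrite scalerDr opprD addrA.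
Qed.

Lemma batch_state_full T Qs rs N (w : T) :
  batch_state Qs rs N k w = sgd Qs rs k C theta0 N.+1 w.
Proof. by rewrite /batch_state addSn -mulSnr. Qed.

Lemma measurable_batch_state d (T : measurableType d) (Qs : nat -> T -> 'M[R]_p)
    (rs : nat -> T -> 'cV[R]_p) N i :
  (forall j, (j < (N * k).+1 + i)%N -> measurable_fun setT (Qs j)) ->
  (forall j, (j < (N * k).+1 + i)%N -> measurable_fun setT (rs j)) ->
  measurable_fun setT (batch_state Qs rs N i).
Proof.
move=> mQs mrs.
have mN : measurable_fun setT (sgd Qs rs k C theta0 N).
  apply: measurable_sgd => j jN; [apply: mQs|apply: mrs];
    by rewrite addSn ltnS (leq_trans jN)// leq_addr.
apply: measurable_mxB => //; apply: measurable_mxZ.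
apply: measurable_mx_sum => j; rewrite mem_index_iota => /andP[_ jN].
by apply: measurable_mxD (mrs _ jN); apply: measurable_mxM mN; exact: mQs.
Qed.

Context d (T : measurableType d) (P : probability T R).
Variables (Q : {RV P >-> 'M[R]_p}) (r : {RV P >-> 'cV[R]_p}).
Variables (Qs : nat -> {RV P >-> 'M[R]_p}) (rs : nat -> {RV P >-> 'cV[R]_p}).
Variable thetas : 'cV[R]_p.
Hypothesis qp : quadratic_problem P Q r.
Hypothesis copies :
  independent_copies P (fun w => (Q w, r w)) (fun N w => (Qs N w, rs N w)).
Hypothesis k0 : (0 < k)%N.
Hypothesis thetas_homogeneous : homogeneous_solution P Q r thetas.
Variable lambda : nat -> R.
Hypothesis eigen : nonzero_eigenvalues (mx_mean P Q) lambda.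

Let A := mean_mx Q.
Let B := mean_sandwich Q.
Let X j w := (Qs j w, rs j w).
Local Notation theta := (sgd Qs rs k C theta0).
Local Notation state := (batch_state Qs rs).
Local Open Scope ereal_scope.

Let mX j : measurable_fun setT (X j).
Proof. by apply: measurable_fun_pair; exact: measurable_funPT. Qed.

Lemma measurable_theta N : measurable_fun setT (theta N).
Proof. by apply: measurable_sgd => j _; exact: measurable_funPT. Qed.

Lemma measurable_state N i : measurable_fun setT (state N i).
Proof. by apply: measurable_batch_state => j _; exact: measurable_funPT. Qed.

Let past n := g_sigma_algebraType (past_cylinders X n).

Lemma past_measurable_state N i :
  @measurable_fun _ _ (past ((N * k).+1 + i)) _ setT
    (fun w => (theta N w, state N i w)).
Proof.
have mXn j : (j < (N * k).+1 + i)%N ->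
    @measurable_fun _ _ (past ((N * k).+1 + i)) _ setT (X j).
  by move=> jn; exact: past_measurable.
have mQ j : (j < (N * k).+1 + i)%N ->
    @measurable_fun _ _ (past ((N * k).+1 + i)) _ setT (Qs j).
  by move=> /mXn; exact: measurableT_comp measurable_fst.
have mr j : (j < (N * k).+1 + i)%N ->
    @measurable_fun _ _ (past ((N * k).+1 + i)) _ setT (rs j).
  by move=> /mXn; exact: measurableT_comp measurable_snd.
apply: measurable_fun_pair; last exact: measurable_batch_state.
apply: measurable_sgd => j jN; [apply: mQ|apply: mr];
  by rewrite addSn ltnS (leq_trans jN)// leq_addr.
Qed.

(** The sample number N k + 1 + i is independent of the iterate and of the
    partial update, and distributed as (Q, r).  Tonelli's theorem then lets it
    be averaged out for fixed values of the two; homogeneity is used there, for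
    the base pair only, to write the gradient Q a + r as Q (a - thetas). *)
Lemma integral_sample_step N i l (phi : 'cV[R]_p -> R) :
  measurable_fun setT phi -> (forall v, (0 <= phi v)%R) ->
  let c := (C N.+1 / k%:R)%R in
  \int[P]_w (phi (theta N w) *
     batch_energy Q c l (theta N w - thetas) (state N i.+1 w - thetas))%:E =
  \int[P]_w (phi (theta N w) *
     batch_energy Q c l.+1 (theta N w - thetas) (state N i w - thetas))%:E.
Proof.
move=> mphi phi0 c; set n := ((N * k).+1 + i)%N.
pose V := ('cV[R]_p * 'cV[R]_p)%type.
pose U := ('M[R]_p * 'cV[R]_p)%type.
have mS : measurable_fun setT (fun w => (theta N w, state N i w)).
  apply: measurable_fun_pair; first exact: measurable_theta.
  exact: measurable_state.
pose S : {RV P >-> V} :=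
  HB.pack (fun w => (theta N w, state N i w))
    (isMeasurableFun.Build _ _ _ _ _ mS).
pose Z : {RV P >-> U} := HB.pack (X n) (isMeasurableFun.Build _ _ _ _ _ (mX n)).
have mY : measurable_fun setT (fun w => (Q w, r w)).
  by apply: measurable_fun_pair; exact: measurable_funPT.
pose Y : {RV P >-> U} :=
  HB.pack (fun w => (Q w, r w)) (isMeasurableFun.Build _ _ _ _ _ mY).
pose f (x : V * U) : \bar R := (phi x.1.1 * batch_energy Q c l (x.1.1 - thetas)
    (x.1.2 - c *: (x.2.1 *m x.1.1 + x.2.2) - thetas))%:E.
have mf : measurable_fun setT f.
  have m11 : measurable_fun setT (fun x : V * U => x.1.1).
    by apply: measurableT_comp measurable_fst; exact: measurable_fst.
  have m12 : measurable_fun setT (fun x : V * U => x.1.2).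
    by apply: measurableT_comp measurable_fst; exact: measurable_snd.
  have m21 : measurable_fun setT (fun x : V * U => x.2.1).
    by apply: measurableT_comp measurable_snd; exact: measurable_fst.
  have m22 : measurable_fun setT (fun x : V * U => x.2.2).
    by apply: measurableT_comp measurable_snd; exact: measurable_snd.
  apply/measurable_EFinP; apply: measurable_funM; first exact: measurableT_comp.
  apply: measurable_batch_energy; apply: measurable_mxB => //.
  apply: measurable_mxB => //; apply: measurable_mxZ.
  apply: measurable_mxD => //.
  exact: measurable_mxM.
have f0 x : 0 <= f x.
  by rewrite lee_fin mulr_ge0//; exact: (batch_energy_ge0 qp).
have SZ D E : measurable D -> measurable E ->
    P (S @^-1` D `&` Z @^-1` E) = P (S @^-1` D) * P (Z @^-1` E).
  move=> mD mE; apply: (past_independent mX copies.2) => //.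
  by have := @past_measurable_state N i measurableT _ mD; rewrite setTI.
transitivity (\int[P]_w f (S w, Z w)).
  by apply: eq_integral => w _; rewrite batch_stateS.
rewrite (@integral_independent _ _ _ _ _ _ _ _ S Z Y f SZ (copies.1 n) mf f0).
apply: eq_integral => w _ /=; set a := theta N w; set b := state N i w.
have [_ <-] : has_mean P (fun w' => phi a * batch_energy Q c l (a - thetas)
    (b - c *: (Q w' *m a + r w') - thetas))%R
    (phi a * batch_energy Q c l.+1 (a - thetas) (b - thetas))%R.
  apply: has_meanZ; apply: has_mean_ae (has_mean_batch_energy qp c l _ _).
    apply: measurable_batch_energy; first exact: measurable_cst.
    apply: measurable_mxB => //; apply: measurable_mxB => //.
    apply: measurable_mxZ.
    apply: measurable_mxD (measurable_funPT r).
    by apply: measurable_mxM; first exact: measurable_funPT.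
  apply: filterS (homogeneous_solution_ae qp thetas_homogeneous) => w' stat.
  congr batch_energy; rewrite addrAC; congr (_ - _ *: _ - _)%R.
  by rewrite mulmxBr; apply/eqP; rewrite subr_eq addrAC -addrA stat addr0.
by [].
Qed.

(** The conditional expectation of the next energy given the current iterate,
    tested against a weight phi. *)
Lemma integral_sgd_step N (phi : 'cV[R]_p -> R) :
  measurable_fun setT phi -> (forall v, (0 <= phi v)%R) ->
  \int[P]_w (phi (theta N w) * qform A (theta N.+1 w - thetas))%:E =
  \int[P]_w (phi (theta N w) *
     step_mean A B k (C N.+1) (theta N w - thetas))%:E.
Proof.
move=> mphi phi0; set c := (C N.+1 / k%:R)%R.
have step l : (l <= k)%N ->
  \int[P]_w (phi (theta N w) * qform A (theta N.+1 w - thetas))%:E =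
  \int[P]_w (phi (theta N w) *
     batch_energy Q c l (theta N w - thetas) (state N (k - l) w - thetas))%:E.
  elim: l => [_|l IH lk].
    by apply: eq_integral => w _; rewrite subn0 batch_state_full batch_energy0.
  by rewrite (IH (ltnW lk)) -(subnSK lk); exact: integral_sample_step.
rewrite (step k)//; apply: eq_integral => w _.
by rewrite subnn batch_state0 batch_energy_full.
Qed.

Let energy N w : R := qform A (theta N w - thetas).

Let energy_ge0 N w : (0 <= energy N w)%R.
Proof. by have [_] := mean_mx_psd qp; apply. Qed.

Let measurable_energy N : measurable_fun setT (energy N).
Proof.
apply: measurable_qform; apply: measurable_mxB => //.
exact: measurable_theta.
Qed.

Let measurable_step_mean c :
  measurable_fun setT (fun v : 'cV[R]_p => step_mean A B k c (v - thetas)).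
Proof.
apply: measurable_funD.
  apply: measurable_qform; apply: measurable_mxB; first exact: measurable_mxB.
  by apply: measurable_mxZ; apply: measurable_mxM; last exact: measurable_mxB.
apply: measurable_funM => //.
by apply: measurable_funB; apply: measurable_qform; exact: measurable_mxB.
Qed.

Lemma mean_energyS N :
  \int[P]_w (energy N.+1 w)%:E =
  \int[P]_w (step_mean A B k (C N.+1) (theta N w - thetas))%:E.
Proof.
have := @integral_sgd_step N (fun=> 1%R) (measurable_cst _) (fun=> ler01).
by under eq_integral do rewrite mul1r; under [RHS]eq_integral do rewrite mul1r.
Qed.

Lemma mean_energyS_le N (q : R) : (0 <= q)%R ->
  (forall v, step_mean A B k (C N.+1) v <= q * qform A v)%R ->
  \int[P]_w (energy N.+1 w)%:E <= q%:E * \int[P]_w (energy N w)%:E.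
Proof.
move=> q0 leq; rewrite mean_energyS -ge0_integralZl//; last 2 first.
- exact/measurable_EFinP/measurable_energy.
- by move=> w _; rewrite lee_fin.
apply: ge0_le_integral => //.
- move=> w _; rewrite lee_fin (step_mean_ge0 (mean_mx_sym qp) eigen)//.
  exact: mean_dispersion_ge0 qp.
- apply/measurable_EFinP.
  exact: measurableT_comp (measurable_step_mean _) (measurable_theta N).
- apply/measurable_EFinP/measurable_funM => //; exact: measurable_energy.
- by move=> w _; rewrite -EFinM lee_fin.
Qed.

Let step_mean_dominated c : exists2 K : R, (0 <= K)%R &
  forall v, (step_mean A B k c v <= K * qform A v)%R.
Proof.
have [K K0 leK] := uniform_bound (\rank A)
  (fun j => step_factor k (sup (dispersion_quotients A B)) c (lambda j)).
exists K => // v.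
exact: (step_mean_le (mean_mx_sym qp) eigen (mean_sandwich_sym qp)
  (@mean_sandwich_ker _ _ _ _ _ _ _ qp) v leK).
Qed.

Lemma mean_energy_lty N : \int[P]_w (energy N w)%:E < +oo.
Proof.
elim: N => [|N IH].
  rewrite -[integral _ _ _]/(\int[P]_w cst (qform A (theta0 - thetas))%:E w).
  by rewrite integral_cst//= probability_setT mule1 ltry.
have [K K0 leK] := step_mean_dominated (C N.+1).
by rewrite (le_lt_trans (mean_energyS_le K0 leK))// lte_mul_pinfty.
Qed.

Lemma step_mean_is_cond_exp N :
  is_cond_exp P (g_sigma_algebra_preimage (theta N)) (energy N.+1)
    (fun w => step_mean A B k (C N.+1) (theta N w - thetas)).
Proof.
have sm0 v : (0 <= step_mean A B k (C N.+1) v)%R.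
  rewrite (step_mean_ge0 (mean_mx_sym qp) eigen)//.
  exact: mean_dispersion_ge0 qp.
have msm : measurable_fun setT
    (fun w => step_mean A B k (C N.+1) (theta N w - thetas)).
  exact: measurableT_comp (measurable_step_mean _) (measurable_theta N).
split.
- move=> D mD.
  exists ((fun v => step_mean A B k (C N.+1) (v - thetas)) @^-1` D).
    by rewrite -[X in measurable X]setTI; exact: measurable_step_mean.
  by rewrite setTI.
- apply/integrableP; split; first exact/measurable_EFinP.
  under eq_integral do rewrite /= ger0_norm//.
  by rewrite -mean_energyS mean_energy_lty.
- move=> _ [D mD <-]; rewrite setTI.
  (* Integrating over an event of theta N is weighting by an indicator. *)
  have patchE (g : T -> R) : \int[P]_(w in theta N @^-1` D) (g w)%:E =
      \int[P]_w (\1_D (theta N w) * g w)%:E.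
    rewrite integral_mkcond; apply: eq_integral => w _.
    rewrite /patch indicE (_ : (w \in _) = (theta N w \in D)).
      by case: (_ \in D); rewrite ?mul1r// mul0r.
    by apply/idP/idP; rewrite !inE.
  rewrite !patchE; apply/esym; apply: integral_sgd_step.
    exact: measurable_indic.
  by move=> v; rewrite indicE.
Qed.

End sgd_dynamics.

(** * Uniqueness of conditional expectations *)

Section cond_exp_unique.
Context d (T : measurableType d) (R : realType) (P : probability T R).
Context d' (U : measurableType d') (Z : T -> U).
Hypothesis mZ : measurable_fun setT Z.
Let G := g_sigma_algebra_preimage Z.

Let subG E : G E -> measurable E.
Proof. by move=> [D mD <-]; exact: mZ. Qed.

(** The event where Y' < Y belongs to the conditioning sigma-algebra, so Y and
    Y' have the same integral over it; the positive difference must then vanish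
    almost everywhere there. *)
Lemma is_cond_exp_ae_le X Y Y' : is_cond_exp P G X Y -> is_cond_exp P G X Y' ->
  {ae P, forall w, Y w <= Y' w}.
Proof.
move=> [mY iY intY] [mY' iY' intY'].
have GE : G [set w | Y' w < Y w].
  pose T' := g_sigma_algebra_preimageType Z.
  have mYT (W : T -> R) : (forall D, measurable D -> G (W @^-1` D)) ->
      @measurable_fun _ _ T' R setT W.
    by move=> mW _ D mD; rewrite setTI; exact: mW.
  have := @measurable_fun_ltr _ T' R setT _ _ (mYT _ mY') (mYT _ mY).
  by move=> /(_ measurableT [set true] I); rewrite setTI.
set E := [set w | _] in GE *; have mE := subG GE.
have iYE := integrableS measurableT mE (@subsetT _ _) iY.
have iYE' := integrableS measurableT mE (@subsetT _ _) iY'.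
have int0 : (\int[P]_(w in E) (Y w - Y' w)%:E = 0)%E.
  under eq_integral do rewrite EFinB.
  rewrite integralB//= intY// intY'// subee//.
  by rewrite -(intY' _ GE); exact: integrable_fin_num iYE'.
have /ae_eq_integral_abs : measurable_fun E (fun w => (Y w - Y' w)%:E).
  under eq_fun do rewrite EFinB.
  by have /integrableP[] := integrableB mE iYE iYE'.
move=> /(_ P mE)[+ _].
rewrite (eq_integral (fun w => (Y w - Y' w)%:E)); last first.
  move=> w; rewrite inE => Ew /=.
  by rewrite ger0_norm// subr_ge0 ltW.
move=> /(_ int0); apply: filterS => w /= h.
rewrite leNgt; apply/negP => YY'.
by have [/eqP] := h YY'; rewrite subr_eq0 gt_eqF.
Qed.

Lemma cond_exp_ae_eq X Y : is_cond_exp P G X Y ->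
  {ae P, forall w, cond_exp P X Z w = Y w}.
Proof.
move=> XY.
have XC : is_cond_exp P G X (cond_exp P X Z).
  by apply: (@xgetPex _ (fun=> 0) (is_cond_exp P G X)); exists Y.
apply: filterS2 (is_cond_exp_ae_le XY XC) (is_cond_exp_ae_le XC XY) => w h1 h2.
by apply/eqP; rewrite eq_le h1 h2.
Qed.

End cond_exp_unique.

(** * Convergence and divergence *)

Theorem theorem3p8 (R : realType) (d : measure_display) (T : measurableType d)
    (P : probability T R) (p : nat)
    (Q : {RV P >-> 'M[R]_p}) (r : {RV P >-> 'cV[R]_p})
    (Qs : nat -> {RV P >-> 'M[R]_p}) (rs : nat -> {RV P >-> 'cV[R]_p})
    (k : nat) (C : nat -> R) (theta0 thetas : 'cV[R]_p) (lambda : nat -> R) :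
  quadratic_problem P Q r ->
  independent_copies P (fun w => (Q w, r w)) (fun N w => (Qs N w, rs N w)) ->
  (0 < k)%N ->
  homogeneous_solution P Q r thetas ->
  nonzero_eigenvalues (mx_mean P Q) lambda ->
  let EQ := mx_mean P Q in
  let m := \rank EQ in
  let t := t_Q P Q in
  let s := s_Q P Q in
  let theta := sgd Qs rs k C theta0 in
  let e N w := qform EQ (theta N w - thetas) in
  let bound := convergence_bound lambda m k t in
  [/\ forall N, 0 < C N.+1 -> C N.+1 < bound ->
        (0 < 'E_P[e N])%E -> ('E_P[e N.+1] < 'E_P[e N])%E,
      (forall N, 0 < C N.+1 /\ C N.+1 < bound) ->
      (exists2 delta : R, 0 < delta &
         forall N, delta <= C N.+1 /\ C N.+1 <= bound - delta) ->
        exists K q : R, 0 < q < 1 /\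
          forall N, ('E_P[e N] <= (K * q ^+ N)%:E)%E &
      forall N,
        C N.+1 < 0 \/
        (exists j, divergence_index lambda m k s j /\
           step_threshold lambda k s j < C N.+1) ->
        exists2 rho : R, 1 < rho &
          {ae P, forall w, 0 < e N w ->
             rho * e N w < cond_exp P (e N.+1) (theta N) w}].
Proof.
move=> qp copies k0 hom eigen EQ m t s theta e bound.
have As : EQ^T = EQ := mean_mx_sym qp.
pose B := mean_sandwich Q.
have Bs : B^T = B := mean_sandwich_sym qp.
have kerAB (v : 'cV_p) : EQ *m v = 0 -> B *m v = 0.
  exact: (@mean_sandwich_ker _ _ _ _ _ _ _ qp v).
have disp0 (v : 'cV_p) : 0 <= dispersion EQ B v := mean_dispersion_ge0 qp v.
have [lambda_mono lambda_gt0 _] := eigen.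
rewrite -/EQ -/m in lambda_mono lambda_gt0.
have t0 : 0 <= t := sup_quotients_ge0 As eigen Bs kerAB disp0.
have s0 : 0 <= s := inf_quotients_ge0 As eigen disp0.
have bound_le := convergence_bound_le k0 t0 lambda_mono lambda_gt0.
have Ee_ge0 N : (0 <= \int[P]_w (e N w)%:E)%E.
  by apply: integral_ge0 => w _; rewrite lee_fin (mean_mx_psd qp).2.
have Ee_fin N : (\int[P]_w (e N w)%:E)%E \is a fin_num.
  rewrite ge0_fin_numE//.
  exact: (mean_energy_lty C theta0 qp copies k0 hom eigen N).
have contraction N q : 0 <= q ->
    (forall j, (1 <= j <= m)%N -> step_factor k t (C N.+1) (lambda j) <= q) ->
    (\int[P]_w (e N.+1 w)%:E <= q%:E * \int[P]_w (e N w)%:E)%E.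
  move=> q0 leq.
  apply: (mean_energyS_le theta0 qp copies k0 hom eigen q0) => v.
  exact: (step_mean_le As eigen Bs kerAB v leq).
(* The contraction rate is kept away from 0 because a rate in ]0, 1[ is asked
   for, and because 1 - eps may be negative. *)
have rate (eps : R) : 0 < eps -> 0 < Num.max (1 / 2) (1 - eps) < 1.
  move=> eps0; rewrite lt_max gt_max; apply/andP; split.
    by apply/orP; left; lra.
  by apply/andP; split; lra.
split.
- move=> N C0 Cb; rewrite unlock => EN0.
  have [j jm|eps eps0 eps_le] := @uniform_margin _ m
      (fun j => 1 - step_factor k t (C N.+1) (lambda j)).
    rewrite subr_gt0 (step_factor_lt1 t0 lambda_gt0)//.
    exact: lt_le_trans Cb (bound_le _ jm).
  have /andP[] := rate _ eps0; set q := Num.max _ _ => q0 q1.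
  apply: (@le_lt_trans _ _ (q%:E * \int[P]_w (e N w)%:E)%E).
    apply: contraction (ltW q0) _ => j /eps_le h.
    by rewrite le_max; apply/orP; right; lra.
  by rewrite -[ltRHS]mul1e lte_pmul2r// lte_fin.
- move=> _ [delta delta0 Cdelta].
  have [j jm|eps eps0 eps_le] := @uniform_margin _ m
      (fun j => delta ^+ 2 * lambda j ^+ 2).
    by rewrite mulr_gt0// exprn_gt0// lambda_gt0.
  have /andP[] := rate _ eps0; set q := Num.max _ _ => q0 q1.
  exists (fine (\int[P]_w (e 0 w)%:E)%E), q; split; first by rewrite q0.
  elim=> [|N IH]; rewrite unlock; first by rewrite expr0 mulr1 fineK.
  rewrite unlock in IH.
  apply: (@le_trans _ _ (q%:E * \int[P]_w (e N w)%:E)%E).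
    apply: contraction (ltW q0) _ => j jm.
    rewrite le_max; apply/orP; right.
    have [delta_le le_bound] := Cdelta N.
    have := step_factor_le_margin t0 lambda_gt0 jm delta0 delta_le
      (le_trans le_bound (lerB (bound_le _ jm) (lexx delta))).
    by have := eps_le j jm; lra.
  by rewrite exprS mulrCA EFinM lee_pmul2l// lte_fin.
- move=> N div.
  have [j jm|eps eps0 eps_le] := @uniform_margin _ m
      (fun j => step_factor k s (C N.+1) (lambda j) - 1).
    rewrite subr_gt0 (step_factor_gt1 s0 lambda_gt0)//.
    case: div => [C0|[i [ind Ci]]]; [by left|right].
    apply: le_lt_trans Ci.
    exact: (divergence_index_max k0 s0 lambda_mono lambda_gt0 jm ind).
  (* Half of the margin is given up to make the inequality strict. *)
  exists (1 + eps / 2); first by lra.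
  have := cond_exp_ae_eq (measurable_theta k C theta0 Qs rs N)
    (step_mean_is_cond_exp C theta0 qp copies k0 hom eigen N).
  apply: filterS => w -> eN0.
  apply: (@lt_le_trans _ _ ((1 + eps) * e N w)).
    by rewrite ltr_pM2r//; lra.
  apply: (step_mean_ge As eigen kerAB disp0 _) => j /eps_le; lra.
Qed.
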